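(* Let $m,n\geq 0$ be integers. Then \[ \sum_{k=1}^{n}\frac{(q/z;q)_{k}(vq^m;q)_{k}(z;q)_{n-k}(z;q)_m}{(q;q)_k (v;q)_{k} (q;q)_{n-k}(q^k;q)_{m+1}}z^k -\sum_{k=1}^{m}\frac{(q/z;q)_{k} (vq^n;q)_{k}(z;q)_{m-k}(z;q)_n}{(q;q)_k (v;q)_{k}(q;q)_{m-k}(q^k;q)_{n+1}}z^k \] \[ =\frac{(1-zq^{-1})(z;q)_m(z;q)_n}{(q;q)_{m}(q;q)_{n}}\left(\sum_{k=1}^m\frac{q^k}{(1-zq^{k-1})(1-q^k)}-\sum_{k=1}^n\frac{q^k}{(1-zq^{k-1})(1-q^k)}\right). \]
   Context: For $N\geq 0$, $(x;q)_N=(1-x)(1-xq)\cdots(1-xq^{N-1})$ (with $(x;q)_0=1$). The identity is one of rational functions in $q,z,v$. *)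

(* Defs.v *)
From mathcomp Require Import all_boot all_algebra.
Set Implicit Arguments. Unset Strict Implicit. Unset Printing Implicit Defensive.
Import GRing.Theory.
Local Open Scope ring_scope.

Definition qpoch (F : fieldType) (x q : F) (N : nat) : F :=
  \prod_(i < N) (1 - x * q ^+ i).

(* Main.v *)
(** Everything rests on the q-Pfaff-Saalschutz sum in the polynomial form
    [sum_j [n j] (a)_j (b)_j (e)_(n-j) e^j (a b e q^j)_(n-j) = (a e)_n (b e)_n].
    Read from right to left with [a = q^-m], [b = v z / q], [e = q^(m+1) / z], it
    expands [(q/z)_k (v q^m)_k / (v)_k] in the first sum of the theorem.  After
    exchanging the two summations, the sum over [k] attached to an index [j >= 1]
    is again a Saalschutz sum; its value is symmetric in [m] and [n], and hence
    cancels in the difference.  The terms with [j = 0] form the derivative at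
    [a = 1] of a Saalschutz sum; since a logarithmic derivative of a product is a
    sum, they give the right-hand side. *)

Require Import Defs.
From mathcomp Require Import all_boot all_algebra.
From mathcomp Require Import ring zify.
Import GRing.Theory.
Local Open Scope ring_scope.

Set Implicit Arguments. Unset Strict Implicit.

(** * [q]-Pochhammer symbols, Gaussian binomials and the q-Pfaff-Saalschutz sum *)

Section QPochhammer.
Variables (R : comNzRingType) (q : R).
Implicit Types (x a b e : R) (m n j : nat).

(* [qpoch] over a ring instead of a field, for use over [{poly K}]. *)
Definition qp x n : R := \prod_(i < n) (1 - x * q ^+ i).

Lemma qp0 x : qp x 0 = 1. Proof. exact: big_ord0. Qed.

Lemma qpS x n : qp x n.+1 = qp x n * (1 - x * q ^+ n).
Proof. exact: big_ord_recr. Qed.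

Lemma qpD x m n : qp x (m + n) = qp x m * qp (x * q ^+ m) n.
Proof.
rewrite /qp big_split_ord /=; congr (_ * _); apply: eq_bigr => i _.
by rewrite exprD mulrA.
Qed.

Lemma qpSl x n : qp x n.+1 = (1 - x) * qp (x * q) n.
Proof. by rewrite -add1n qpD qpS qp0 mul1r !expr1 mulr1. Qed.

(** The Gaussian binomial [n j], given by Pascal's rule so that no division occurs and polynomials
    over a field are covered too. *)
Fixpoint qbin n j : R :=
  match n, j with
  | _, 0 => 1
  | 0, _.+1 => 0
  | n'.+1, j'.+1 => qbin n' j' + q ^+ j * qbin n' j
  end.

Lemma qbin0 n : qbin n 0 = 1. Proof. by case: n. Qed.

Lemma qbin_small n j : (n < j)%N -> qbin n j = 0.
Proof.
elim: n j => [|n IHn] [|j] //= ltnj.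
by rewrite !IHn ?mulr0 ?addr0 // ltnW.
Qed.

Lemma qbinn n : qbin n n = 1.
Proof. by elim: n => //= n ->; rewrite qbin_small // mulr0 addr0. Qed.

(** Absorption rule with denominators cleared. Pascal's rule leads to both (j, d-1) and (j-1, d),
    hence the induction on [j + d]. *)
Lemma qbin_shift d j :
  qbin (j + d) j.+1 * (1 - q ^+ j.+1) = qbin (j + d) j * (1 - q ^+ d).
Proof.
move: {2}(j + d)%N (erefl (j + d)%N) => n; elim: n j d => [|n IHn] j d.
  by case: j d => [|j] [|d] //= _; rewrite expr0; ring.
move=> def_n; rewrite def_n.
case: d def_n => [|d] def_n.
  rewrite addn0 in def_n; rewrite expr0 qbin_small ?def_n //; ring.
have jdn: (j + d = n)%N by lia.
have IH1 : qbin n j.+1 * (1 - q ^+ j.+1) = qbin n j * (1 - q ^+ d).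
  by have := IHn j d jdn; rewrite jdn.
case: j def_n jdn IH1 => [|i] def_n jdn IH1.
  rewrite add0n in jdn; subst d; rewrite /= !qbin0 in IH1 *.
  by rewrite !exprS expr0 in IH1 *; rewrite mulrDl -mulrA IH1; ring.
have IH2 : qbin n i.+1 * (1 - q ^+ i.+1) = qbin n i * (1 - q ^+ d.+1).
  by have := IHn i d.+1; rewrite addnS -addSn jdn; apply.
rewrite /= [in LHS]mulrDl -mulrA IH1 [RHS]mulrDl -IH2.
by rewrite !exprS; ring.
Qed.

Lemma qbin_qp d j : qbin (j + d) j * qp q j * qp q d = qp q (j + d).
Proof.
elim: j d => [|j IHj] d; first by rewrite qbin0 qp0 !mul1r.
rewrite addSnnS -IHj [qp q j.+1]qpS [qp q d.+1]qpS -!exprS.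
have /= := qbin_shift d.+1 j => E.
rewrite !mulrA [_ * (1 - q ^+ d.+1)]mulrC !mulrA.
by rewrite [(1 - q ^+ d.+1) * _]mulrC -E; ring.
Qed.

Let term a b e n j := qbin n j * qp a j * qp b j * qp e (n - j) * e ^+ j
  * qp (a * b * e * q ^+ j) (n - j).

(* Certificate of a Wilf-Zeilberger recurrence shifting [(n, e)] to
   [(n + 1, e / q)]. *)
Let cert a b e n j := (if j is i.+1 then qbin n i else 0) * qp a j * qp b j *
  qp (e * q) (n.+1 - j) * e ^+ j * qp (a * b * e * q ^+ j) (n.+1 - j).

Lemma term_recurrence a b e n j : (j <= n)%N ->
  term a b e n.+1 j = (1 - a * e) * (1 - b * e) * term a b (e * q) n j
    - (cert a b e n j.+1 - cert a b e n j).
Proof.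
move=> lejn; have [d ->] : exists d, n = (j + d)%N.
  by exists (n - j)%N; rewrite subnKC.
rewrite /term /cert (_ : (j + d).+1 - j = d.+1)%N ?subSS ?addKn; last by lia.
(* [P] is [n j-1], read as 0 when [j = 0]. *)
set P := (if j is i.+1 then _ else _).
have EP : P * (1 - q ^+ d.+1) = qbin (j + d) j * (1 - q ^+ j).
  rewrite /P; case: (j) => [|i]; first by rewrite expr0; ring.
  by rewrite addSnnS -qbin_shift.
have EB : qbin (j + d).+1 j = P + q ^+ j * qbin (j + d) j.
  by rewrite /P; case: (j) => [|i] //=; rewrite qbin0 expr0 mul1r add0r.
rewrite EB (qpS a) (qpS b) [qp (e * q) d.+1]qpS [qp e _]qpSl.
rewrite [qp (_ * q ^+ j) d.+1]qpSl.
have -> : a * b * (e * q) * q ^+ j = a * b * e * q ^+ j * q by ring.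
have -> : a * b * e * q ^+ j.+1 = a * b * e * q ^+ j * q by rewrite exprS; ring.
rewrite exprMn -[e * q * _]mulrA -[q * q ^+ d]exprS [e ^+ j.+1]exprS.
set B := qbin (j + d) j in EP *; set Q := q ^+ d.+1 in EP *.
set X := q ^+ j in EP *; set K1 := qp (e * q) d; set K2 := qp _ d.
set A1 := qp a j; set B1 := qp b j; set E := e ^+ j.
apply/eqP; rewrite -subr_eq0; apply/eqP.
(* Pascal's rule has left only [B] and [P]. With these as free variables, the two sides differ by
   this multiple of the absorption rule [EP]. *)
transitivity (e * (1 - a * b * e * X) * A1 * B1 * E * K1 * K2 *
   (B * (1 - X) - P * (1 - Q))); last by rewrite EP subrr mulr0.
by ring.
Qed.

(** Induction with [e] general, since the recurrence replaces [e] by [e * q]. The certificate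
    telescopes; its last value cancels the term [j = n + 1], which lies outside the range of the
    recurrence. *)
Lemma q_saalschutz a b e n :
  \sum_(0 <= j < n.+1) qbin n j * qp a j * qp b j * qp e (n - j) * e ^+ j
    * qp (a * b * e * q ^+ j) (n - j) = qp (a * e) n * qp (b * e) n.
Proof.
rewrite -/(term a b e n); elim: n e => [|n IHn] e.
  by rewrite big_nat1 /term /= !qp0 expr0 !mulr1.
rewrite big_nat_recr //= (eq_big_nat _ _ (F2 := fun j =>
  (1 - a * e) * (1 - b * e) * term a b (e * q) n j
  - (cert a b e n j.+1 - cert a b e n j))); last first.
  by move=> j /andP[_ ?]; apply: term_recurrence.
rewrite sumrB -mulr_sumr IHn telescope_sumr // /term /cert !subnn !qp0 !qbinn !mulr1.
rewrite [qp (a * e) _]qpSl [qp (b * e) _]qpSl !mulrA (@qbin_small n) //; ring.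
Qed.
End QPochhammer.

(** * The derivative of the Saalschutz sum at [a = 1] *)

Section Derivative.
Variables (K : fieldType) (q : K).

Lemma horner_qp (p : {poly K}) n x : (qp q%:P p n).[x] = qp q p.[x] n.
Proof.
rewrite /qp horner_prod; apply: eq_bigr => i _.
by rewrite -polyC_exp !hornerE.
Qed.

Lemma qbin_polyC n j : qbin q%:P n j = (qbin q n j)%:P.
Proof.
elim: n j => [|n IHn] [|j] //=.
by rewrite !IHn -polyC_exp -polyCM -polyCD.
Qed.

Lemma qp_polyC x n : qp q%:P x%:P n = (qp q x n)%:P.
Proof.
rewrite /qp rmorph_prod; apply: eq_bigr => i _.
by rewrite -polyC_exp -polyCM -polyCB.
Qed.

Lemma deriv_qp c n : (forall i, (i < n)%N -> 1 - c * q ^+ i != 0) ->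
  (qp q%:P ('X * c%:P) n)^`().[1]
    = - (qp q c n * \sum_(0 <= i < n) c * q ^+ i / (1 - c * q ^+ i)).
Proof.
elim: n => [|n IHn] nz.
  by rewrite !qp0 big_geq // mulr0 oppr0 derivC horner0.
rewrite !qpS derivM hornerD !hornerM IHn; last by move=> i lti; apply/nz/ltnW.
rewrite big_nat_recr //= horner_qp -polyC_exp !derivE !hornerE.
by field; apply: nz.
Qed.

(** Saalschutz over polynomials with [a = 'X], differentiated at 1. The right-hand side and the term
    [j = 0] yield the two logarithmic derivatives. *)
Lemma q_saalschutz_deriv b e n :
  (forall i, (i < n)%N -> 1 - e * q ^+ i != 0) ->
  (forall i, (i < n)%N -> 1 - b * e * q ^+ i != 0) ->
  \sum_(1 <= j < n.+1) qbin q n j * qp q q j.-1 * qp q b j * qp q e (n - j)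
     * e ^+ j * qp q (b * e * q ^+ j) (n - j)
  = qp q e n * qp q (b * e) n *
    (\sum_(0 <= i < n) e * q ^+ i / (1 - e * q ^+ i)
     - \sum_(0 <= i < n) b * e * q ^+ i / (1 - b * e * q ^+ i)).
Proof.
move=> nze nzb.
have := q_saalschutz q%:P 'X b%:P e%:P n.
rewrite big_ltn // subn0 !qp0 !expr0 qbin0 !mul1r !mulr1 -mulrA -!polyCM !qp_polyC.
(* For j >= 1, (X)_j = (1 - X) (qX)_(j-1), so the j-th term is (1 - X) Q_j, with derivative -Q_j(1)
   at 1. *)
pose Q j := (qbin q n j * qp q b j * qp q e (n - j) * e ^+ j)%:P
  * qp q%:P ('X * q%:P) j.-1 * qp q%:P ('X * (b * e * q ^+ j)%:P) (n - j).
rewrite (eq_big_nat _ _ (F2 := fun j => (1 - 'X) * Q j)) => [|[|j] // _].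
  rewrite -mulr_sumr => /(congr1 (fun p => p^`().[1])).
  rewrite derivD !derivM !derivE !hornerE !deriv_qp //=.
  rewrite horner_sum => E.
  rewrite (eq_bigr (fun j => (Q j).[1])) => [|j _].
    apply/eqP; rewrite -subr_eq0; apply/eqP.
    move/eqP: E; rewrite -subr_eq0 => /eqP E.
    by rewrite -[RHS]oppr0 -[in RHS]E; ring.
  by rewrite /Q !hornerE !horner_qp !hornerE; ring.
rewrite /Q [qp _ 'X j.+1]qpSl /= qbin_polyC !qp_polyC !polyCM !polyC_exp.
by rewrite !mulrA; ring.
Qed.
End Derivative.

(** * Expansion of (q/z)_k (v q^m)_k / (v)_k *)

Section Main.
Variables (K : fieldType) (q z : K).
Hypotheses (q_neq0 : q != 0) (z_neq0 : z != 0).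

Lemma qp_neq0 x n : (forall i, (i < n)%N -> 1 - x * q ^+ i != 0) ->
  qp q x n != 0.
Proof. by move=> nz; apply/prodf_neq0 => i _; apply: nz. Qed.

(** Factor by factor, (1 - q^(i-m)) q^m = -q^i (1 - q^(m-i)). *)
Lemma qp_qinv m j : (j <= m)%N ->
  qp q (q ^- m) j * (q ^+ m) ^+ j * qp q q (m - j)
    = qp q q m * \prod_(0 <= i < j) - q ^+ i.
Proof.
elim: j => [|j IHj] ltjm; first by rewrite qp0 big_geq // subn0; ring.
rewrite big_nat_recr //= mulrA -IHj ?(ltnW ltjm) // qpS.
have -> : (m - j = (m - j.+1).+1)%N by lia.
have [d def_m] : exists d, m = (d + j.+1)%N by exists (m - j.+1)%N; lia.
rewrite [in RHS]qpS -exprS def_m addnK [_ ^+ j.+1]exprSr.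
set X := qp q (q ^- _) j; set Y := (_ ^+ _) ^+ j; set Z := qp q q d.
rewrite addnS -addSn !exprD; field.
by rewrite !expf_neq0.
Qed.

Lemma qp_qinv_small m j : (m < j)%N -> qp q (q ^- m) j = 0.
Proof.
move=> ltmj; rewrite -(subnKC ltmj) qpD qpS mulVf ?expf_neq0 //.
by rewrite subrr mulr0 mul0r.
Qed.

Variable v : K.

(** The part of the j-th expansion coefficient that does not depend on [k]. *)
Let coef m j := qp q (q ^- m) j * qp q (v * z / q) j
  * (q ^+ m.+1 / z) ^+ j / qp q v j.

(** The parameters satisfy a e = q/z, b e = v q^m and a b e = v, so the last factor (v q^j)_(k-j) of
    Saalschutz cancels against (v)_k and leaves 1 / (v)_j. *)
Lemma expand_ratio m k : (forall i, (i < k)%N -> 1 - v * q ^+ i != 0) ->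
  qp q (q / z) k * qp q (v * q ^+ m) k / qp q v k
  = \sum_(0 <= j < k.+1) qbin q k j * coef m j * qp q (q ^+ m.+1 / z) (k - j).
Proof.
move=> nzv; have := q_saalschutz q (q ^- m) (v * z / q) (q ^+ m.+1 / z) k.
have -> : q ^- m * (q ^+ m.+1 / z) = q / z.
  by rewrite exprS; field; rewrite ?z_neq0 ?q_neq0 ?expf_neq0.
have -> : v * z / q * (q ^+ m.+1 / z) = v * q ^+ m.
  by rewrite exprS; field; rewrite ?z_neq0 ?q_neq0 ?expf_neq0.
move=> <-; rewrite mulr_suml; apply: eq_big_nat => j /andP[_ lejk].
have -> : q ^- m * (v * z / q) * (q ^+ m.+1 / z) = v.
  by rewrite exprS; field; rewrite ?z_neq0 ?q_neq0 ?expf_neq0.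
have def_k := subnKC (lejk : (j <= k)%N).
rewrite /coef -[in qp q v k]def_k qpD; field.
rewrite !qp_neq0 // => i lti; last by apply/nzv/(leq_trans lti).
by rewrite -mulrA -exprD; apply: nzv; lia.
Qed.

(** * Evaluation of one sum of the theorem; the other is obtained by exchanging [m] and [n] *)

Section FirstSum.
Variables m n : nat.
Hypothesis nzq : forall i, (i < m + n)%N -> 1 - q * q ^+ i != 0.
Hypothesis nzv : forall i, (i < n)%N -> 1 - v * q ^+ i != 0.
Hypothesis nzz : forall i, (i < n)%N -> 1 - z * q ^+ i != 0.

Lemma qpq_neq0 i : (i <= m + n)%N -> qp q q i != 0.
Proof. by move=> lei; apply: qp_neq0 => j ltj; apply/nzq/(leq_trans ltj). Qed.

(** Since (q)_(k-1) (q^k)_(m+1) (q^(m+k+1))_(n-k) = (q)_(m+n), the weight gets a denominator free of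
    [k] and a numerator of Saalschutz shape. *)
Lemma inv_weightE k : (0 < k <= n)%N ->
  (qp q q k * qp q q (n - k) * qp q (q ^+ k) m.+1)^-1
  = qbin q n k * qp q q k.-1 * qp q (q ^+ m.+1 * q ^+ k) (n - k)
    / (qp q q n * qp q q (m + n)).
Proof.
case: k => // k /andP[_ lekn].
have Eqn : qbin q n k.+1 * qp q q k.+1 * qp q q (n - k.+1) = qp q q n.
  by have := qbin_qp q (n - k.+1) k.+1; rewrite subnKC.
have Eqk : qp q q k * qp q (q ^+ k.+1) m.+1 = qp q q (k + m.+1).
  by rewrite qpD -exprS.
have Eqm : qp q q (k + m.+1) * qp q (q ^+ m.+1 * q ^+ k.+1) (n - k.+1)
    = qp q q (m + n).
  have -> : (m + n = k + m.+1 + (n - k.+1))%N by lia.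
  by rewrite [RHS]qpD -exprS -exprD; congr (_ * qp q (q ^+ _) _); lia.
have := qpq_neq0 (leqnn _); rewrite -Eqm -Eqk !mulf_eq0 !negb_or.
case/andP=> /andP[nzk nzkm] nzr.
have := qpq_neq0 (leq_addl m n); rewrite -Eqn !mulf_eq0 !negb_or.
case/andP=> /andP[nzb nzk1] nznk.
by rewrite /=; field; rewrite nzk nzkm nzr nzb nzk1 nznk.
Qed.

(** Trinomial revision [n j+i] [j+i j] = [n j] [n-j i], with [n j] written through q-factorials. *)
Lemma qbin_mul_qbin i j : (i + j <= n)%N ->
  qbin q n (j + i) * qbin q (j + i) j * (qp q q j * qp q q (n - j))
  = qp q q n * qbin q (n - j) i.
Proof.
move=> leij; have [d def_n] : exists d, n = (j + i + d)%N.
  by exists (n - (j + i))%N; lia.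
have E1 := qbin_qp q d (j + i); have E2 := qbin_qp q i j.
have E3 := qbin_qp q d i.
rewrite def_n -E1 -E2 -[in qp q q (_ - j)]addnA addKn -E3.
rewrite -addnA addKn; ring.
Qed.

(* The contribution of the index [j >= 1] of the expansion. *)
Definition cross j := coef m j * z ^+ j * qp q z m * qp q q j.-1
  * qp q (z * q ^+ j) (n - j) * qp q (q ^+ m.+1) (n - j)
  / (qp q q j * qp q q (n - j) * qp q q (m + n)).

Lemma first_sumE :
  \sum_(1 <= k < n.+1)
     (qp q (q / z) k * qp q (v * q ^+ m) k * qp q z (n - k) * qp q z m)
     / (qp q q k * qp q v k * qp q q (n - k) * qp q (q ^+ k) m.+1) * z ^+ k
  = qp q z m * qp q z n / (qp q q m * qp q q n)
    * (\sum_(0 <= i < n) z * q ^+ i / (1 - z * q ^+ i)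
       - \sum_(0 <= i < n) q ^+ m.+1 * q ^+ i / (1 - q ^+ m.+1 * q ^+ i))
    + \sum_(1 <= j < n.+1) cross j.
Proof.
pose B := q ^+ m.+1 / z.
have Bz : B * z = q ^+ m.+1 by rewrite divfK.
pose W k := qbin q n k * qp q q k.-1 * qp q (q ^+ m.+1 * q ^+ k) (n - k)
  * z ^+ k * qp q z (n - k).
pose C := qp q z m / (qp q q n * qp q q (m + n)).
(* The inner range is extended from [j <= k] to [j <= n], where [k j] = 0, so that the sums can be
   exchanged. *)
transitivity (\sum_(1 <= k < n.+1) \sum_(0 <= j < n.+1)
    C * W k * (qbin q k j * coef m j * qp q B (k - j))).
  apply: eq_big_nat => k /andP[k_gt0 lekn].
  rewrite [RHS](big_cat_nat _ (n := k.+1)) //=.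
  rewrite [X in _ = _ + X]big_nat_cond [X in _ = _ + X]big1 ?addr0; last first.
    by move=> j /andP[/andP[ltkj _] _]; rewrite (qbin_small _ ltkj) !mul0r mulr0.
  rewrite -mulr_sumr -expand_ratio => [|i lti]; last first.
    by apply/nzv/(leq_trans lti).
  have := inv_weightE (introT andP (conj k_gt0 lekn)).
  rewrite /C /W !invfM => E.
  transitivity (qp q (q / z) k * qp q (v * q ^+ m) k / qp q v k
    * qp q z (n - k) * qp q z m * z ^+ k *
    ((qp q q k)^-1 / qp q q (n - k) / qp q (q ^+ k) m.+1)); first by ring.
  by rewrite E; ring.
rewrite exchange_big_nat //= big_ltn //; congr (_ + _).
  (* At [j = 0] the factor (q)_(k-1) is what differentiating (a)_k at [a = 1] leaves: the derivative
     form applies with [b = B] and [e = z]. *)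
  transitivity (C * \sum_(1 <= k < n.+1) qbin q n k * qp q q k.-1 * qp q B k
     * qp q z (n - k) * z ^+ k * qp q (B * z * q ^+ k) (n - k)).
    rewrite mulr_sumr; apply: eq_bigr => k _.
    by rewrite /W subn0 qbin0 /coef !qp0 expr0 Bz invr1; ring.
  have nzqm i : (i < n)%N -> 1 - q ^+ m.+1 * q ^+ i != 0.
    by move=> lti; rewrite exprS -mulrA -exprD; apply: nzq; rewrite ltn_add2l.
  rewrite q_saalschutz_deriv ?Bz // /C qpD -exprS.
  have nzm := qp_neq0 nzqm.
  set U := _ - _; field.
  by rewrite nzm !qpq_neq0 ?leq_addl ?leq_addr.
apply: eq_big_nat => j /andP[j_gt0 lejn].
rewrite (big_cat_nat _ (n := j)) //=; last exact: ltnW.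
rewrite big_nat_cond big1 ?add0r; last first.
  by move=> k /andP[/andP[_ ltkj] _]; rewrite (qbin_small _ ltkj) !mul0r mulr0.
rewrite -{1}[j]add0n big_addn.
have -> : (n.+1 - j = (n - j).+1)%N by rewrite subSn.
(* With k = j + i and j >= 1, (q)_(k-1) = (q)_(j-1) (q^j)_i, which gives a Saalschutz sum of length
   n - j with [a = q ^+ j], [b = B], [e = z]. *)
transitivity (qp q z m * coef m j * z ^+ j * qp q q j.-1
    / (qp q q j * qp q q (n - j) * qp q q (m + n)) *
  \sum_(0 <= i < (n - j).+1) qbin q (n - j) i * qp q (q ^+ j) i * qp q B i
    * qp q z (n - j - i) * z ^+ i * qp q (q ^+ j * B * z * q ^+ i) (n - j - i)).
  rewrite mulr_sumr; apply: eq_big_nat => i /andP[_]; rewrite ltnS => lei.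
  have leijn : (i + j <= n)%N by lia.
  have E := qbin_mul_qbin leijn.
  rewrite /W addnK [(i + j)%N]addnC subnDA /C.
  have -> : qp q q (j + i).-1 = qp q q j.-1 * qp q (q ^+ j) i.
    have -> : ((j + i).-1 = j.-1 + i)%N by lia.
    by rewrite qpD -exprS prednK.
  have -> : q ^+ m.+1 * q ^+ (j + i) = q ^+ j * B * z * q ^+ i.
    by rewrite exprD -[_ * B * z]mulrA Bz; ring.
  have nzn := qpq_neq0 (leq_addl m n).
  have -> : qbin q (n - j) i = qbin q n (j + i) * qbin q (j + i) j
     * (qp q q j * qp q q (n - j)) / qp q q n.
    by rewrite E mulrAC mulfV // mul1r.
  by rewrite exprD; field; rewrite nzn !qpq_neq0 //; lia.
rewrite q_saalschutz Bz /cross [q ^+ j * z]mulrC.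
ring.
Qed.
End FirstSum.

(** * Symmetry of the terms with [j >= 1] *)

Lemma cross_small m n j : (m < j)%N -> cross m n j = 0.
Proof. by move=> ltmj; rewrite /cross /coef qp_qinv_small // !mul0r. Qed.

(* Up to the order of factors, the right-hand side is invariant under
   exchanging [m] and [n]. *)
Lemma crossE m n j : (forall i, (i < m + n)%N -> 1 - q * q ^+ i != 0) ->
  (j <= m)%N -> (j <= n)%N ->
  cross m n j = qp q (v * z / q) j / qp q v j * q ^+ j * qp q q j.-1
    * (\prod_(0 <= i < j) - q ^+ i) * qp q z j
    * (qp q (z * q ^+ j) (m - j) * qp q (z * q ^+ j) (n - j))
    * qp q q (m + n - j)
    / (qp q q j * (qp q q (m - j) * qp q q (n - j)) * qp q q (m + n)).
Proof.
move=> nzq lejm lejn.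
have nzqp := qpq_neq0 nzq.
have -> : (m + n - j = m + (n - j))%N by rewrite addnBA.
(* (q^(m+1))_(n-j) is (q)_(m+n-j) / (q)_m, and this (q)_m cancels the one produced by (q^-m)_j. *)
rewrite [qp q q (m + (n - j))]qpD -exprS.
have E := qp_qinv lejm.
have Ez : qp q z m = qp q z j * qp q (z * q ^+ j) (m - j).
  by rewrite -qpD subnKC.
have -> : \prod_(0 <= i < j) - q ^+ i
    = qp q (q ^- m) j * (q ^+ m) ^+ j * qp q q (m - j) / qp q q m.
  by rewrite E mulrAC mulfV ?mul1r // nzqp ?leq_addr.
rewrite /cross /coef Ez expr_div_n exprS exprMn.
(* (v)_j may vanish here; with its inverse opaque, [field] asks for no condition on it. *)
set w := (qp q v j)^-1; field.
by rewrite expf_neq0 // !nzqp //; lia.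
Qed.

Lemma sum_cross_sym m n : (forall i, (i < m + n)%N -> 1 - q * q ^+ i != 0) ->
  \sum_(1 <= j < n.+1) cross m n j = \sum_(1 <= j < m.+1) cross n m j.
Proof.
(* The factor (q^-m')_j vanishes for j > m', so both sums stop at the minimum of [m] and [n]. *)
have trunc m' n' : \sum_(1 <= j < n'.+1) cross m' n' j
    = \sum_(1 <= j < (minn m' n').+1) cross m' n' j.
  rewrite (big_cat_nat _ (n := (minn m' n').+1)) //= ?ltnS ?geq_minr //.
  rewrite [X in _ + X]big_nat_cond [X in _ + X]big1 ?addr0 // => j.
  by case/andP=> /andP[ltj ltjn] _; rewrite cross_small //; lia.
move=> nzq; rewrite trunc [RHS]trunc minnC; apply: eq_big_nat => j /andP[_ ltj].
have nzq' i : (i < n + m)%N -> 1 - q * q ^+ i != 0 by rewrite addnC; apply: nzq.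
rewrite !crossE //; try lia.
rewrite [(n + m)%N]addnC [qp q q (n - j) * _]mulrC.
by rewrite [qp q _ (n - j) * _]mulrC.
Qed.
End Main.

(** * Comparison of the [j = 0] terms with the right-hand side *)

Unset Implicit Arguments. Set Strict Implicit.

Theorem theorem1p3 (F : fieldType) (m n : nat) (q z v : F) :
  q != 0 -> z != 0 ->
  (forall j : nat, (1 <= j <= m + n + 1)%N -> q ^+ j != 1) ->
  (forall j : nat, (j < maxn m n)%N -> v * q ^+ j != 1) ->
  (forall j : nat, (j < maxn m n)%N -> z * q ^+ j != 1) ->
  \sum_(1 <= k < n.+1)
     (qpoch (q / z) q k * qpoch (v * q ^+ m) q k * qpoch z q (n - k) * qpoch z q m)
     / (qpoch q q k * qpoch v q k * qpoch q q (n - k) * qpoch (q ^+ k) q m.+1)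
     * z ^+ k
  - \sum_(1 <= k < m.+1)
     (qpoch (q / z) q k * qpoch (v * q ^+ n) q k * qpoch z q (m - k) * qpoch z q n)
     / (qpoch q q k * qpoch v q k * qpoch q q (m - k) * qpoch (q ^+ k) q n.+1)
     * z ^+ k
  = (1 - z * q^-1) * qpoch z q m * qpoch z q n / (qpoch q q m * qpoch q q n)
    * (\sum_(1 <= k < m.+1) q ^+ k / ((1 - z * q ^+ k.-1) * (1 - q ^+ k))
       - \sum_(1 <= k < n.+1) q ^+ k / ((1 - z * q ^+ k.-1) * (1 - q ^+ k))).
Proof.
move=> q_neq0 z_neq0 q_neq v_neq z_neq.
have nzq i : (i < m + n)%N -> 1 - q * q ^+ i != 0.
  by move=> lti; rewrite subr_eq0 eq_sym -exprS; apply: q_neq; lia.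
have nzq' i : (i < n + m)%N -> 1 - q * q ^+ i != 0 by rewrite addnC; apply: nzq.
have nzv i : (i < maxn m n)%N -> 1 - v * q ^+ i != 0.
  by move=> lti; rewrite subr_eq0 eq_sym; apply: v_neq.
have nzz i : (i < maxn m n)%N -> 1 - z * q ^+ i != 0.
  by move=> lti; rewrite subr_eq0 eq_sym; apply: z_neq.
have ltmax_l i : (i < m)%N -> (i < maxn m n)%N by move=> ?; lia.
have ltmax_r i : (i < n)%N -> (i < maxn m n)%N by move=> ?; lia.
have qpochE x k : qpoch x q k = qp q x k by [].
rewrite !qpochE; under eq_bigr do rewrite !qpochE.
under [X in _ - X]eq_bigr do rewrite !qpochE.
rewrite !first_sumE //; try by move=> i lti; auto.
rewrite (sum_cross_sym q_neq0 z_neq0 v nzq).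
pose A k := \sum_(0 <= i < k) z * q ^+ i / (1 - z * q ^+ i).
(* [L p k] sums q^i / (1 - q^i) over p < i <= p + k, hence the additivity [L_split]. *)
pose L p k := \sum_(0 <= i < k) q ^+ p.+1 * q ^+ i / (1 - q ^+ p.+1 * q ^+ i).
have L_split p k : L 0 (p + k)%N = L 0 p + L p k.
  rewrite /L (big_cat_nat _ (n := p)) ?leq_addr //= -{2}[p]add0n big_addn addKn.
  congr (_ + _); apply: eq_bigr => i _.
  by rewrite expr1 -exprS -exprD addSn addnC.
(* Partial fractions: (1 - z/q) q^i / ((1 - z q^(i-1)) (1 - q^i)) = q^i / (1 - q^i) - z q^(i-1) / (1
   - z q^(i-1)). *)
have H k : (k <= maxn m n)%N ->
    (1 - z * q^-1) * (\sum_(1 <= i < k.+1)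
      q ^+ i / ((1 - z * q ^+ i.-1) * (1 - q ^+ i))) = L 0 k - A k.
  move=> lek; rewrite big_add1 mulr_sumr /L /A -sumrB.
  apply: eq_big_nat => i /andP[_ lti] /=; rewrite expr1 exprS.
  field; rewrite q_neq0 nzz ?nzq //; lia.
rewrite -/(A m) -/(A n) -/(L m n) -/(L n m).
(* Both sums contain the same [L 0 (m + n)], which drops out of the difference. *)
have -> : L m n = L 0 (m + n)%N - L 0 m by rewrite L_split addrC addKr.
have -> : L n m = L 0 (m + n)%N - L 0 n by rewrite addnC L_split addrC addKr.
have Hm := H m (leq_maxl _ _); have Hn := H n (leq_maxr _ _).
set Sm := \sum_(1 <= i < m.+1) _ / _ in Hm *.
set Sn := \sum_(1 <= i < n.+1) _ / _ in Hn *.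
transitivity (qp q z m * qp q z n / (qp q q m * qp q q n)
  * ((1 - z * q^-1) * Sm - (1 - z * q^-1) * Sn)); last by ring.
by rewrite Hm Hn [qp q z n * qp q z m]mulrC [qp q q n * _]mulrC; ring.
Qed.
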